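(* Let $(G,\mathfrak{B})$ be a Rota-Baxter Lie group with identity $e$ and Lie algebra $(\mathfrak{g},[\cdot,\cdot]_{\mathfrak{g}})$, and let $B=\mathfrak{B}_{*e}:\mathfrak{g}\to\mathfrak{g}$. (1) The pair $(G,* )$, with multiplication $g_1*g_2:=g_1\,\mathrm{Ad}_{\mathfrak{B}(g_1)}g_2$ for $g_1,g_2\in G$, is also a Lie group, whose Lie algebra is $(\mathfrak{g},[\cdot,\cdot]_B)$, where $[u,v]_B=[B(u),v]_{\mathfrak{g}}+[u,B(v)]_{\mathfrak{g}}+[u,v]_{\mathfrak{g}}$ for $u,v\in\mathfrak{g}$. (2) The map $\mathfrak{B}$ is a Rota-Baxter operator on the Lie group $(G,* )$. (3) The map $\mathfrak{B}:(G,* )\to G$ is a homomorphism of Rota-Baxter Lie groups from $(G,*,\mathfrak{B})$ to $(G,\mathfrak{B})$.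
   Context: For a group $G$, $\mathrm{Ad}_g h:=ghg^{-1}$. A Rota-Baxter operator on a Lie group $G$ is a smooth map $\mathfrak{B}:G\to G$ such that $\mathfrak{B}(g_1)\mathfrak{B}(g_2)=\mathfrak{B}(g_1\,\mathrm{Ad}_{\mathfrak{B}(g_1)}g_2)$ for all $g_1,g_2\in G$ (products and $\mathrm{Ad}$ taken in the group considered); $(G,\mathfrak{B})$ is then a Rota-Baxter Lie group. A homomorphism of Rota-Baxter Lie groups $(G,\mathfrak{B})\to(G',\mathfrak{B}')$ is a Lie group homomorphism $\Phi:G\to G'$ with $\Phi\circ\mathfrak{B}=\mathfrak{B}'\circ\Phi$. *)

(* Defs.v *)
From HB Require Import structures.
From mathcomp Require Import all_boot all_order all_algebra.
From mathcomp Require Import all_classical all_reals all_analysis.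

Set Implicit Arguments.
Unset Strict Implicit.
Unset Printing Implicit Defensive.
Import Order.TTheory GRing.Theory Num.Theory.
Import numFieldNormedType.Exports.

Local Open Scope classical_set_scope.
Local Open Scope ring_scope.

(* C^k on an open set U. With finite-dimensional E (the only case used),
   continuity of all iterated directional derivatives is the usual notion. *)
Fixpoint Ck_on (R : realType) (E F : normedModType R) (k : nat) (U : set E)
    (f : E -> F) : Prop :=
  match k with
  | 0%N => forall x, U x -> {for x, continuous f}
  | k'.+1 => (forall x, U x -> differentiable f x) /\
             (forall v, Ck_on k' U (fun x => 'D_v f x))
  end.

Definition smooth_on (R : realType) (E F : normedModType R) (U : set E)
    (f : E -> F) : Prop :=
  forall k, Ck_on k U f.

(* A chart is a partial homeomorphism from the open set [cdom] onto its image;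
   [cmap] and [cinv] are total, their values elsewhere being irrelevant. *)
Record chart (R : realType) (T : topologicalType) (E : normedModType R) :=
  Chart { cdom : set T; cmap : T -> E; cinv : E -> T }.

HB.instance Definition _ (R : realType) (T : topologicalType)
  (E : normedModType R) := gen_eqMixin (chart T E).
HB.instance Definition _ (R : realType) (T : topologicalType)
  (E : normedModType R) := gen_choiceMixin (chart T E).

Definition is_chart (R : realType) (T : topologicalType) (E : normedModType R)
    (c : chart T E) : Prop :=
  [/\ open (cdom c),
      open (cmap c @` cdom c),
      forall p, cdom c p -> cinv c (cmap c p) = p,
      forall p, cdom c p -> {for p, continuous (cmap c)} &
      forall p, cdom c p -> {for cmap c p, continuous (cinv c)}].

Definition is_manifold (R : realType) (T : topologicalType)
    (E : normedModType R) (A : set (chart T E)) : Prop :=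
  [/\ hausdorff_space T,
      @second_countable T,
      forall c, A c -> is_chart c,
      forall p, exists2 c, A c & cdom c p &
      forall c d, A c -> A d ->
        smooth_on (cmap c @` (cdom c `&` cdom d)) (cmap d \o cinv c)].

Definition smooth_map (R : realType) (T T' : topologicalType)
    (E E' : normedModType R) (A : set (chart T E)) (A' : set (chart T' E'))
    (f : T -> T') : Prop :=
  continuous f /\
  forall c d, A c -> A' d ->
    smooth_on (cmap c @` (cdom c `&` f @^-1` cdom d)) (cmap d \o f \o cinv c).

Definition prod_chart (R : realType) (T T' : topologicalType)
    (E E' : normedModType R) (c : chart T E) (d : chart T' E') :
    chart (T * T')%type (E * E')%type :=
  Chart (cdom c `*` cdom d)
    (fun p => (cmap c p.1, cmap d p.2)) (fun y => (cinv c y.1, cinv d y.2)).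

Definition prod_atlas (R : realType) (T T' : topologicalType)
    (E E' : normedModType R) (A : set (chart T E)) (A' : set (chart T' E')) :
    set (chart (T * T')%type (E * E')%type) :=
  [set e | exists c d, [/\ A c, A' d & e = prod_chart c d]].

(* A chosen chart of the atlas at p (the default value is never used on a
   manifold). The tangent space T_p M is the model space E, a vector being
   represented by its coordinates in [chart_at A p]. *)
Definition chart_at (R : realType) (T : topologicalType) (E : normedModType R)
    (A : set (chart T E)) (p : T) : chart T E :=
  xget (Chart set0 (cst 0) (cst p)) [set c | A c /\ cdom c p].

(* f_{*p} : T_p M -> T_{f p} M' *)
Definition tangent_map (R : realType) (T T' : topologicalType)
    (E E' : normedModType R) (A : set (chart T E)) (A' : set (chart T' E'))
    (f : T -> T') (p : T) : E -> E' :=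
  'd (cmap (chart_at A' (f p)) \o f \o cinv (chart_at A p))
     (cmap (chart_at A p) p).

(* Components, in the fixed chart c, of a vector field X with X q in T_q M:
   X q is transported from [chart_at A q] to c. *)
Definition vfield_in_chart (R : realType) (T : topologicalType)
    (E : normedModType R) (A : set (chart T E)) (c : chart T E) (X : T -> E) :
    E -> E :=
  fun y => let q := cinv c y in
    'd (cmap c \o cinv (chart_at A q)) (cmap (chart_at A q) q) (X q).

(* [X, Y](p) = DY(X) - DX(Y), i.e. [X, Y]^i = X^j d_j Y^i - Y^j d_j X^i, so
   that [X, Y] f = X (Y f) - Y (X f). *)
Definition vfield_bracket (R : realType) (T : topologicalType)
    (E : normedModType R) (A : set (chart T E)) (X Y : T -> E) (p : T) : E :=
  let c := chart_at A p in
  let x := vfield_in_chart A c X in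
  let y := vfield_in_chart A c Y in
  'd y (cmap c p) (x (cmap c p)) - 'd x (cmap c p) (y (cmap c p)).

Record group_ops (T : Type) :=
  GroupOps { gmul : T -> T -> T; gone : T; ginv : T -> T }.

Definition is_group (T : Type) (G : group_ops T) : Prop :=
  [/\ associative (gmul G),
      left_id (gone G) (gmul G),
      right_id (gone G) (gmul G),
      left_inverse (gone G) (@ginv T G) (gmul G) &
      right_inverse (gone G) (@ginv T G) (gmul G)].

Definition Ad (T : Type) (G : group_ops T) (g h : T) : T :=
  gmul G (gmul G g h) (ginv G g).

Definition is_lie_group (R : realType) (T : topologicalType)
    (E : normedModType R) (A : set (chart T E)) (G : group_ops T) : Prop :=
  [/\ is_manifold A,
      is_group G,
      smooth_map (prod_atlas A A) A (fun p : T * T => gmul G p.1 p.2) &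
      smooth_map A A (@ginv T G)].

(* u in T_e G extended to g |-> (L_g)_* u *)
Definition left_inv_vfield (R : realType) (T : topologicalType)
    (E : normedModType R) (A : set (chart T E)) (G : group_ops T) (u : E) :
    T -> E :=
  fun g => tangent_map A A (gmul G g) (gone G) u.

Definition lie_bracket (R : realType) (T : topologicalType)
    (E : normedModType R) (A : set (chart T E)) (G : group_ops T) (u v : E) :
    E :=
  vfield_bracket A (left_inv_vfield A G u) (left_inv_vfield A G v) (gone G).

Definition is_rota_baxter (R : realType) (T : topologicalType)
    (E : normedModType R) (A : set (chart T E)) (G : group_ops T)
    (B : T -> T) : Prop :=
  smooth_map A A B /\
  forall g1 g2, gmul G (B g1) (B g2) = B (gmul G g1 (Ad G (B g1) g2)).

Definition is_rota_baxter_lie_group (R : realType) (T : topologicalType)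
    (E : normedModType R) (A : set (chart T E)) (G : group_ops T)
    (B : T -> T) : Prop :=
  is_lie_group A G /\ is_rota_baxter A G B.

Definition is_lie_group_hom (R : realType) (T T' : topologicalType)
    (E E' : normedModType R) (A : set (chart T E)) (A' : set (chart T' E'))
    (G : group_ops T) (G' : group_ops T') (Phi : T -> T') : Prop :=
  smooth_map A A' Phi /\ {morph Phi : x y / gmul G x y >-> gmul G' x y}.

Definition is_rota_baxter_hom (R : realType) (T T' : topologicalType)
    (E E' : normedModType R) (A : set (chart T E)) (A' : set (chart T' E'))
    (G : group_ops T) (B : T -> T) (G' : group_ops T') (B' : T' -> T')
    (Phi : T -> T') : Prop :=
  [/\ is_rota_baxter_lie_group A G B,
      is_rota_baxter_lie_group A' G' B',
      is_lie_group_hom A A' G G' Phi &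
      Phi \o B =1 B' \o Phi].

Definition rb_mul (T : Type) (G : group_ops T) (B : T -> T) (g1 g2 : T) : T :=
  gmul G g1 (Ad G (B g1) g2).

Definition rb_bracket (R : realType) (T : topologicalType)
    (E : normedModType R) (A : set (chart T E)) (G : group_ops T)
    (B : T -> T) (u v : E) : E :=
  let b := tangent_map A A B (gone G) in
  lie_bracket A G (b u) v + lie_bracket A G u (b v) + lie_bracket A G u v.

(* Main.v *)
From HB Require Import structures.
Require Import Defs.
From mathcomp Require Import all_boot all_order all_algebra.
From mathcomp Require Import all_classical all_reals all_analysis.

Set Implicit Arguments.
Unset Strict Implicit.
Unset Printing Implicit Defensive.
Import Order.TTheory GRing.Theory Num.Theory.
Import numFieldNormedType.Exports.

Local Open Scope classical_set_scope.
Local Open Scope ring_scope.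

(** Write [g * h = g Ad_(B g) h] for the descendent product.

    The algebra rests on one remark: the Rota-Baxter identity says that [B]
    sends [*] to the product of [G]. Associativity of [*] is then the fact that
    [Ad] is an action by automorphisms, the inverse of [g] is
    [Ad_((B g)^-1) (g^-1)], and, since [B] carries conjugation of the descendent
    group to conjugation of [G], applying [B] to [g1 * (conjugate of g2)] gives
    the Rota-Baxter identity for [*]. Product and inverse are
    composites of smooth maps, so the same atlas makes [*] a Lie group. This
    needs the chain rule for maps that are smooth in the sense of iterated
    directional derivatives ([Ck_on_comp]), and smoothness of composites and
    pairs on manifolds ([smooth_map_comp], [smooth_map_pair]).

    For the bracket, read everything in one chart around the identity [e], with
    [m] the product, [a(y, z)] the conjugate of [z] by [y], and [b] the map [B].
    Let [beta_m(u, v)] be the derivative of [m] in its second argument along [v]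
    and then in its first along [u], at [(e, e)]. The left-invariant field of
    [v] is [y |-> D_(0, v) m (y, e)], so the Lie bracket is
    [beta_m(u, v) - beta_m(v, u)] ([lie_bracketE]). Two computations finish:
    - differentiating [a(y, z) y = y z] twice gives
      [beta_a(u, v) = beta_m(u, v) - beta_m(v, u) = [u, v]], by symmetry of
      second derivatives ([derive_sym], [mixed_derive_conj]);
    - differentiating [m'(y, z) = m(y, a(b y, z))] twice gives
      [beta_m'(u, v) = beta_m(u, v) + beta_a(b' u, v)] ([mixed_derive_twist]).
    Antisymmetrizing the second formula and inserting the first yields
    [[u, v]' = [u, v] + [b' u, v] - [b' v, u]], which is the claimed bracket. *)

(** * Directional derivatives and differentials *)

Section Calculus.
Context {R : realType}.
Implicit Types E F H : normedModType R.

(** Chart expressions agree with smooth maps only near a point, so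
    differentiability has to be transported along local equalities. *)
Lemma near_eq_differentiable E F (f g : E -> F) x : (\near x, f x = g x) ->
  differentiable f x -> differentiable g x.
Proof.
move=> fg df; have fgx := nbhs_singleton fg.
have dfc := diff_continuous df.
have eqg : g \o shift x = cst (g x) + 'd f x +o_ 0 id.
  apply/eqaddoP => _/posnumP[e].
  have /eqaddoP/(_ e%:num (gt0 e)) := diff_locally df.
  have fg0 : \forall h \near 0, f (h + x) = g (h + x).
    by move: fg; rewrite (near_shift 0) subr0.
  apply: filterS2 fg0 => h fgh.
  by rewrite !fctE /= fgh fgx.
apply/diff_locallyP; rewrite (diff_unique dfc eqg); split=> //.
Qed.

Lemma derive_comp E F H (f : E -> F) (g : F -> H) x v :
  differentiable f x -> differentiable g (f x) ->
  'D_v (g \o f) x = 'D_('D_v f x) g (f x).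
Proof.
move=> df dg; rewrite (deriveE _ df) (deriveE _ dg).
by rewrite (deriveE _ (differentiable_comp df dg)) (diff_comp df dg).
Qed.

Lemma derive_pair E F H (f : E -> F) (g : E -> H) x v :
  differentiable f x -> differentiable g x ->
  'D_v (fun y => (f y, g y)) x = ('D_v f x, 'D_v g x).
Proof.
move=> df dg; rewrite (deriveE _ df) (deriveE _ dg).
by rewrite (deriveE _ (differentiable_pair df dg)) (diff_pair df dg).
Qed.

Lemma derive_lin E F (f : {linear E -> F}) x v : continuous f ->
  'D_v f x = f v.
Proof.
by move=> fc; rewrite (deriveE _ (linear_differentiable x fc)) (diff_lin x fc).
Qed.

Lemma derive_dirD E F (f : E -> F) x u v : differentiable f x ->
  'D_(u + v) f x = 'D_u f x + 'D_v f x.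
Proof. by move=> df; rewrite !(deriveE _ df) linearD. Qed.

(** Packaging scaling as a bilinear map brings the product rule of a scalar
    function with a vector-valued one under the chain rule. *)
Lemma scale_bilinear F : bilinear_for (GRing.Scale.Law.clone _ _ *:%R _)
  (GRing.Scale.Law.clone _ _ *:%R _) (fun (k : R) (w : F) => k *: w).
Proof.
split=> [u'|u] a y z /=; first by rewrite scalerDl scalerA.
by rewrite scalerDr !scalerA mulrC.
Qed.

Let scale_bil F : {bilinear R -> F -> F} :=
  HB.pack (fun (k : R) (w : F) => k *: w)
    (bilinear_isBilinear.Build R R F F _ _ _ (scale_bilinear F)).

Let scale_bil_continuous F : continuous (fun p : R * F => scale_bil F p.1 p.2).
Proof. exact: scale_continuous. Qed.

Lemma differentiable_scale E F (s : E -> R) (f : E -> F) x :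
  differentiable s x -> differentiable f x ->
  differentiable (fun y => s y *: f y) x.
Proof.
move=> ds df; exact: (differentiable_comp (differentiable_pair ds df)
  (differentiable_bilin (s x, f x) (@scale_bil_continuous F))).
Qed.

Lemma derive_scale E F (s : E -> R) (f : E -> F) x v :
  differentiable s x -> differentiable f x ->
  'D_v (fun y => s y *: f y) x = 'D_v s x *: f x + s x *: 'D_v f x.
Proof.
move=> ds df; have dp := differentiable_pair ds df.
have dm := differentiable_bilin (s x, f x) (@scale_bil_continuous F).
rewrite [LHS](derive_comp v dp dm) (derive_pair v ds df) (deriveE _ dm).
by rewrite (diff_bilin _ (@scale_bil_continuous F)) /= addrC.
Qed.

End Calculus.

(** * Closure properties of C^k maps *)

Section CkClosure.
Context {R : realType}.
Implicit Types E F H : normedModType R.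

Lemma open_setX (S T : topologicalType) (U : set S) (V : set T) :
  open U -> open V -> open (U `*` V).
Proof.
move=> oU oV; rewrite openE => -[x y] [Ux Vy]; exists (U, V) => //.
by split; apply: open_nbhs_nbhs.
Qed.

Lemma Ck_on_sub E F k (U V : set E) (f : E -> F) : V `<=` U ->
  Ck_on k U f -> Ck_on k V f.
Proof.
move=> VU; elim: k f => [|k IH] f /=; first by move=> h x /VU/h.
by move=> [df hf]; split=> [x /VU/df //|v]; exact: IH.
Qed.

(** [Ck_on] constrains the derivatives point by point, so it glues along any
    cover. *)
Lemma Ck_on_local E F k (U : set E) (f : E -> F) :
  (forall x, U x -> exists2 V : set E, V x & Ck_on k V f) -> Ck_on k U f.
Proof.
elim: k f => [|k IH] f /= h.
  by move=> x /h[V Vx]; exact.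
split=> [x /h[V Vx [df _]]|v]; first exact: df.
by apply: IH => x /h[V Vx [_ hv]]; exists V.
Qed.

Lemma open_near_eq E F (U : set E) (f g : E -> F) x : open U -> U x ->
  (forall y, U y -> f y = g y) -> \near x, f x = g x.
Proof.
move=> oU Ux fg; apply: filterS (open_nbhs_nbhs (conj oU Ux)).
by move=> y; exact: fg.
Qed.

Lemma Ck_on_eq E F k (U : set E) (f g : E -> F) : open U ->
  (forall x, U x -> f x = g x) -> Ck_on k U f -> Ck_on k U g.
Proof.
move=> oU; elim: k f g => [|k IH] f g fg /=.
  move=> cf x Ux; have nfg := open_near_eq oU Ux fg.
  rewrite /prop_for /continuous_at -(fg _ Ux); apply: cvg_trans (cf x Ux).
  by apply: near_eq_cvg; exact: filterS nfg.
move=> [df hf]; split=> [x Ux|v].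
  exact: near_eq_differentiable (open_near_eq oU Ux fg) (df x Ux).
apply: IH (hf v) => x Ux.
exact: near_eq_derive (open_near_eq oU Ux fg).
Qed.

Lemma Ck_onW E F k (U : set E) (f : E -> F) : Ck_on k.+1 U f -> Ck_on k U f.
Proof.
elim: k f => [|k IH] f [df hf].
  by move=> x Ux; exact: differentiable_continuous (df x Ux).
by split=> // v; exact: IH (hf v).
Qed.

Lemma Ck_on_cst E F k (U : set E) (a : F) : Ck_on k U (fun=> a : F).
Proof.
elim: k a => [|k IH] a /=; first by move=> x _; exact: cvg_cst.
split=> [x _|v]; first exact: differentiable_cst.
rewrite [X in Ck_on _ _ X](_ : _ = fun=> 0); first exact: IH.
by apply/funext => x; rewrite -(derive_cst a x v).
Qed.

Lemma Ck_on_lin E F k (U : set E) (f : {linear E -> F}) : continuous f ->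
  Ck_on k U f.
Proof.
move=> fc; case: k => [|k] /=; first by move=> x _; exact: fc.
split=> [x _|v]; first exact: linear_differentiable.
rewrite [X in Ck_on _ _ X](_ : _ = fun=> f v); first exact: Ck_on_cst.
by apply/funext => x; rewrite derive_lin.
Qed.

Lemma Ck_onD E F k (U : set E) (f g : E -> F) : open U ->
  Ck_on k U f -> Ck_on k U g -> Ck_on k U (fun x => f x + g x).
Proof.
move=> oU; elim: k f g => [|k IH] f g.
  by move=> cf cg x Ux; exact: (cvgD (cf x Ux) (cg x Ux)).
move=> [df hf] [dg hg]; split=> [x Ux|v].
  exact: differentiableD (df x Ux) (dg x Ux).
apply: Ck_on_eq (IH _ _ (hf v) (hg v)) => // x Ux.
exact/esym/(deriveD (diff_derivable (df x Ux)) (diff_derivable (dg x Ux))).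
Qed.

Lemma Ck_on_scale E F k (U : set E) (s : E -> R) (f : E -> F) : open U ->
  Ck_on k U s -> Ck_on k U f -> Ck_on k U (fun x => s x *: f x).
Proof.
move=> oU; elim: k s f => [|k IH] s f.
  by move=> cs cf x Ux; exact: (cvgZ (cs x Ux) (cf x Ux)).
move=> hs hf; have [ds hs'] := hs; have [df hf'] := hf; split=> [x Ux|v].
  exact: differentiable_scale (ds x Ux) (df x Ux).
apply: (@Ck_on_eq _ _ _ _ (fun x => 'D_v s x *: f x + s x *: 'D_v f x)) => //.
  by move=> x Ux; rewrite (derive_scale v (ds x Ux) (df x Ux)).
exact: (Ck_onD oU (IH _ _ (hs' v) (Ck_onW hf)) (IH _ _ (Ck_onW hs) (hf' v))).
Qed.

Lemma Ck_on_sum E F k (U : set E) m (f : 'I_m -> E -> F) : open U ->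
  (forall i, Ck_on k U (f i)) -> Ck_on k U (fun x => \sum_i f i x).
Proof.
move=> oU; elim: m f => [|m IH] f hf.
  by apply: Ck_on_eq (Ck_on_cst _ _ 0) => // x _; rewrite big_ord0.
apply: (@Ck_on_eq _ _ _ _
  (fun x => \sum_(i < m) f (widen_ord (leqnSn m) i) x + f ord_max x)) => //.
  by move=> x _; rewrite big_ord_recr.
by apply: Ck_onD => //; exact: IH.
Qed.

Lemma Ck_on_pair E F H k (U : set E) (f : E -> F) (g : E -> H) : open U ->
  Ck_on k U f -> Ck_on k U g -> Ck_on k U (fun x => (f x, g x)).
Proof.
move=> oU; elim: k f g => [|k IH] f g.
  by move=> cf cg x Ux; exact: (cvg_pair (cf x Ux) (cg x Ux)).
move=> [df hf] [dg hg]; split=> [x Ux|v].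
  exact: differentiable_pair (df x Ux) (dg x Ux).
apply: Ck_on_eq (IH _ _ (hf v) (hg v)) => // x Ux.
by rewrite (derive_pair v (df x Ux) (dg x Ux)).
Qed.

Lemma Ck_on_lincomp E F H k (U : set E) (f : E -> F) (L : {linear F -> H}) :
  open U -> continuous L -> Ck_on k U f -> Ck_on k U (L \o f).
Proof.
move=> oU cL; elim: k f => [|k IH] f.
  by move=> cf x Ux; exact: (continuous_comp (cf x Ux) (cL _)).
move=> [df hf]; split=> [x Ux|v].
  exact: differentiable_comp (df x Ux) (linear_differentiable _ cL).
apply: Ck_on_eq (IH _ (hf v)) => // x Ux.
by rewrite (derive_comp _ (df x Ux) (linear_differentiable _ cL)) derive_lin.
Qed.

(** Stated through a finite spanning family with continuous linear coefficients:
    this is the form in which directions get expanded below, and it covers row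
    vectors and their products alike. *)
Definition finite_dim E :=
  exists m (b : 'I_m -> E) (c : 'I_m -> {linear E -> R}),
  (forall i, continuous (c i)) /\ forall x, x = \sum_i c i x *: b i.

Lemma finite_dim_rV n : finite_dim 'rV[R]_n.
Proof.
have lc (i : 'I_n) : linear (fun x : 'rV[R]_n => x 0 i).
  by move=> a x y; rewrite !mxE.
pose c i : {linear 'rV[R]_n -> R} :=
  HB.pack (fun x : 'rV[R]_n => x 0 i) (GRing.isLinear.Build _ _ _ _ _ (lc i)).
exists n, (fun i => delta_mx 0 i), c; split=> [i|x].
  exact: coord_continuous.
exact: row_sum_delta.
Qed.

Lemma finite_dim_prod E F : finite_dim E -> finite_dim F ->
  finite_dim (E * F)%type.
Proof.
move=> [m [b [c [cc cE]]]] [p [b' [c' [cc' cE']]]].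
have l1 i : linear (fun x : E * F => c i x.1).
  by move=> a x y /=; rewrite linearP.
have l2 i : linear (fun x : E * F => c' i x.2).
  by move=> a x y /=; rewrite linearP.
pose d1 i : {linear (E * F)%type -> R} :=
  HB.pack (fun x : E * F => c i x.1) (GRing.isLinear.Build _ _ _ _ _ (l1 i)).
pose d2 i : {linear (E * F)%type -> R} :=
  HB.pack (fun x : E * F => c' i x.2) (GRing.isLinear.Build _ _ _ _ _ (l2 i)).
exists (m + p)%N, (fun i => match fintype.split i with
    inl i => (b i, 0) | inr i => (0, b' i) end),
  (fun i => match fintype.split i with inl i => d1 i | inr i => d2 i end).
split=> [i|x].
  case: (fintype.split i) => j x.
    apply: (@continuous_comp _ _ _ fst (c j)); first exact: cvg_fst.
    exact: cc.
  apply: (@continuous_comp _ _ _ snd (c' j)); first exact: cvg_snd.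
  exact: cc'.
rewrite big_split_ord /=.
under eq_bigr => i _ do rewrite (unsplitK (inl i : 'I_m + 'I_p)) /=.
under [X in _ + X]eq_bigr => i _ do rewrite (unsplitK (inr i : 'I_m + 'I_p)) /=.
case: x => x y /=.
have -> : \sum_(i < m) c i x *: ((b i, 0) : E * F) = (x, 0).
  rewrite {2}(cE x).
  rewrite (big_morph (fun z => (z, 0) : E * F) (id1 := 0) (op1 := +%R)) //.
    by apply: eq_bigr => i _; congr pair; rewrite scaler0.
  by move=> u v; congr pair; rewrite addr0.
have -> : \sum_(i < p) c' i y *: ((0, b' i) : E * F) = (0, y).
  rewrite {2}(cE' y).
  rewrite (big_morph (fun z => (0, z) : E * F) (id1 := 0) (op1 := +%R)) //.
    by apply: eq_bigr => i _; congr pair; rewrite scaler0.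
  by move=> u v; congr pair; rewrite addr0.
by congr pair; rewrite ?addr0 ?add0r.
Qed.

Lemma derive_basis E F m (b : 'I_m -> E) (c : 'I_m -> {linear E -> R})
    (f : E -> F) x v : (forall x, x = \sum_i c i x *: b i) ->
  differentiable f x -> 'D_v f x = \sum_i c i v *: 'D_(b i) f x.
Proof.
move=> cE df; rewrite (deriveE _ df) {1}(cE v) linear_sum.
by apply: eq_bigr => i _; rewrite linearZ (deriveE _ df).
Qed.

(** The iterated derivatives in [Ck_on] are directional, whereas the chain rule
    differentiates [g] in the direction ['D_v f x], which moves with [x].
    Expanding that direction over a finite spanning family of [F] leaves fixed
    directions with C^k coefficients, to which the induction hypothesis
    applies. *)
Lemma Ck_on_comp E F H k (U : set E) (W : set F) (f : E -> F) (g : F -> H) :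
  finite_dim F -> open U -> (forall x, U x -> W (f x)) ->
  Ck_on k U f -> Ck_on k W g -> Ck_on k U (g \o f).
Proof.
move=> [m [b [c [cc cE]]]] oU fUW; elim: k f g fUW => [|k IH] f g fUW.
  by move=> cf cg x Ux; exact: (continuous_comp (cf x Ux) (cg _ (fUW _ Ux))).
move=> hf hg; have [df hf'] := hf; have [dg hg'] := hg; split=> [x Ux|v].
  by apply: differentiable_comp; [exact: df|exact/dg/fUW].
apply: (@Ck_on_eq _ _ _ _
    (fun x => \sum_i (c i \o 'D_v f) x *: ('D_(b i) g \o f) x)) => //.
  move=> x Ux; have dgx := dg _ (fUW _ Ux).
  by rewrite (derive_comp v (df x Ux) dgx) (derive_basis _ cE dgx).
apply: Ck_on_sum => // i; apply: Ck_on_scale => //;[|].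
  exact: (Ck_on_lincomp oU (cc i) (hf' v)).
exact: (IH _ _ fUW (Ck_onW hf) (hg' (b i))).
Qed.

(** The tangent map loses one derivative but keeps smoothness jointly in the
    point and the direction, again by expanding the direction over a finite
    spanning family. *)
Lemma Ck_on_tangent E F k (U : set E) (f : E -> F) :
  finite_dim E -> open U -> Ck_on k.+1 U f ->
  Ck_on k (U `*` setT) (fun p : E * E => 'D_(p.2) f p.1).
Proof.
move=> fE oU [df hf]; have [m [b [c [cc cE]]]] := fE.
have oUT : open (U `*` [set: E]) by apply: open_setX => //; exact: openT.
apply: (@Ck_on_eq _ _ _ _
    (fun p : E * E => \sum_i (c i \o snd) p *: ('D_(b i) f \o fst) p)) => //.
  by move=> p [Up _]; rewrite -(derive_basis _ cE)//; exact: df.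
apply: Ck_on_sum => // i; apply: Ck_on_scale => //;[|].
  apply: (Ck_on_lincomp oUT (cc i)).
  by apply: Ck_on_lin => x; exact: cvg_snd.
have fstk : Ck_on k (U `*` [set: E]) (fst : E * E -> E).
  by apply: Ck_on_lin => x; exact: cvg_fst.
by apply: (Ck_on_comp fE oUT _ fstk (hf (b i))) => p [].
Qed.

End CkClosure.

(** * Symmetry of second derivatives *)

Section Schwarz.
Context {R : realType}.
Implicit Types E F : normedModType R.

Lemma derive_along_line E F (f : E -> F) (a u : E) (s : R) :
  differentiable f (a + s *: u) ->
  differentiable (fun s : R => f (a + s *: u)) s /\
  'D_1 (fun s : R => f (a + s *: u)) s = 'D_u f (a + s *: u).
Proof.
move=> df.
have dl : is_diff s (fun s : R => a + s *: u) ( *:%R^~ u).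
  by apply: is_diff_eq; rewrite add0r.
have dl1 : differentiable (fun s : R => a + s *: u) s.
  exact: (@ex_diff _ _ _ _ _ _ _ dl).
split; first exact: (differentiable_comp dl1 df).
rewrite [LHS](derive_comp (1 : R) dl1 df) (deriveE (1 : R) dl1) diff_val.
by rewrite scale1r.
Qed.

Lemma MVT_along_line E (f : E -> R) (a u : E) (h : R) : 0 < h ->
  (forall s, 0 <= s <= h -> differentiable f (a + s *: u)) ->
  exists2 s, 0 <= s <= h & f (a + h *: u) - f a = h * 'D_u f (a + s *: u).
Proof.
move=> h0 df.
have dg s : 0 <= s <= h -> is_derive s 1 (fun s : R => f (a + s *: u))
    ('D_u f (a + s *: u)).
  move=> /df/derive_along_line[ds <-]; apply: DeriveDef => //.
  exact: diff_derivable.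
have [s|s|s sh e] := @MVT R (fun s : R => f (a + s *: u))
    (fun s : R => 'D_u f (a + s *: u)) _ _ h0.
- by rewrite in_itv /= => /andP[/ltW s0 /ltW sh]; apply: dg; rewrite s0.
- apply: continuous_in_subspaceT => t; rewrite inE /= in_itv /= => th.
  exact/differentiable_continuous/(derive_along_line (df t th)).1.
exists s; first by move: sh; rewrite in_itv /= => /andP[/ltW -> /ltW ->].
by rewrite mulrC -[h in RHS]subr0 -e scale0r addr0.
Qed.

(** The mean value theorem, applied along [u] and then along [v], expresses the
    second difference of [f] over a parallelogram as a mixed derivative at one
    of its points. *)
Lemma second_difference E (f : E -> R) (a u v : E) (h : R) : 0 < h ->
  (forall s t, 0 <= s <= h -> 0 <= t <= h ->
    differentiable f (a + s *: u + t *: v) /\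
    differentiable ('D_u f) (a + s *: u + t *: v)) ->
  exists s t, [/\ 0 <= s <= h, 0 <= t <= h &
    (f (a + h *: u + h *: v) - f (a + h *: u)) - (f (a + h *: v) - f a)
    = h * (h * 'D_v ('D_u f) (a + s *: u + t *: v))].
Proof.
move=> h0 df.
have hh : 0 <= h <= h by rewrite (ltW h0) lexx.
have h00 : 0 <= (0 : R) <= h by rewrite lexx (ltW h0).
pose g x := f (x + h *: v) - f x.
have dsh x : differentiable f (x + h *: v) ->
    differentiable (fun x => f (x + h *: v)) x /\
    'D_u (fun x => f (x + h *: v)) x = 'D_u f (x + h *: v).
  move=> dfx.
  have dt : is_diff x (fun x => x + h *: v) id.
    by apply: is_diff_eq; rewrite addr0.
  have dt1 : differentiable (fun x => x + h *: v) x.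
    exact: (@ex_diff _ _ _ _ _ _ _ dt).
  split; first exact: differentiable_comp dt1 dfx.
  by rewrite [LHS](derive_comp u dt1 dfx) (deriveE u dt1) diff_val.
have dg s : 0 <= s <= h -> differentiable g (a + s *: u) /\
    'D_u g (a + s *: u) = 'D_u f (a + s *: u + h *: v) - 'D_u f (a + s *: u).
  move=> sh; have [d1 _] := df _ _ sh hh.
  have [d0 _] := df _ _ sh h00; rewrite scale0r addr0 in d0.
  have [ds De] := dsh _ d1.
  split; first exact: differentiableB ds d0.
  by rewrite -De; exact: deriveB (diff_derivable ds) (diff_derivable d0).
have [s sh es] := MVT_along_line h0 (fun s sh => (dg s sh).1).
have [t th et] := MVT_along_line h0 (fun t th => (df s t sh th).2).
exists s, t; split => //.
by rewrite -et -(dg s sh).2 -es.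
Qed.

Lemma dist_half (a b y e : R) : `|a - y| < e / 2 -> `|b - y| < e / 2 ->
  `|a - b| <= e.
Proof.
move=> ay yb; rewrite -(subrK y a) -addrA (le_trans (ler_normD _ _))//.
by rewrite (splitr e) lerD ?ltW// distrC.
Qed.

(** The second difference is symmetric in [u] and [v], so the two mixed
    derivatives agree at two points of an arbitrarily small parallelogram, hence
    at the corner by continuity. *)
Lemma derive_sym_scalar E (U : set E) (f : E -> R) (x u v : E) :
  open U -> U x -> Ck_on 2 U f -> 'D_u ('D_v f) x = 'D_v ('D_u f) x.
Proof.
move=> oU Ux [df hf]; apply/eqP; rewrite -subr_eq0 -normr_le0.
apply/ler_addgt0Pl => e e0; rewrite addr0.
have [du cu] := hf u; have [dv cv] := hf v.
have near_e : \forall y \near x, [/\ U y,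
    `|'D_u ('D_v f) x - 'D_u ('D_v f) y| < e / 2 &
    `|'D_v ('D_u f) x - 'D_v ('D_u f) y| < e / 2].
  have e2 : 0 < e / 2 by rewrite divr_gt0.
  have /cvgrPdist_lt/(_ _ e2) cvu := cv u x Ux.
  have /cvgrPdist_lt/(_ _ e2) cuv := cu v x Ux.
  have nU := open_nbhs_nbhs (conj oU Ux).
  move: nU cvu cuv; apply: filterS3 => y Uy d1 d2.
  by split; [exact: Uy|exact: d1|exact: d2].
have /nbhs_ballP[r /= r0 hr] := near_e.
(* the side is chosen so that the parallelogram stays in the ball of radius r;
   the 1 keeps the denominator positive and the inclusion strict *)
pose h := r / (`|u| + `|v| + 1).
have d0 : 0 < `|u| + `|v| + 1 by rewrite ltr_wpDl ?addr_ge0.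
have h0 : 0 < h by rewrite divr_gt0.
have inball s t : 0 <= s <= h -> 0 <= t <= h -> ball x r (x + s *: u + t *: v).
  move=> /andP[s0 sh] /andP[t0 th].
  rewrite -ball_normE /= -addrA opprD addrA subrr add0r normrN.
  apply: (le_lt_trans (ler_normD _ _)).
  rewrite !normrZ (ger0_norm s0) (ger0_norm t0).
  apply: (@le_lt_trans _ _ (h * (`|u| + `|v|))).
    by rewrite mulrDr lerD// ler_wpM2r.
  by rewrite /h mulrAC ltr_pdivrMr// ltr_pM2l// ltrDl.
have [s|s [t [sh th e1]]] := @second_difference _ f x u v h h0.
  move=> t sh th; have [Uy _ _] := hr _ (inball s t sh th).
  by split; [exact: df|exact: du].
have [s'|s' [t' [sh' th' e2]]] := @second_difference _ f x v u h h0.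
  move=> t' sh' th'; rewrite addrAC.
  have [Uy _ _] := hr _ (inball t' s' th' sh').
  by split; [exact: df|exact: dv].
have [_ _ n1] := hr _ (inball s t sh th).
have [_ n2 _] := hr _ (inball t' s' th' sh').
have eqD : 'D_v ('D_u f) (x + s *: u + t *: v) =
           'D_u ('D_v f) (x + t' *: u + s' *: v).
  have hn0 : h != 0 by rewrite gt_eqF.
  apply: (mulfI hn0); apply: (mulfI hn0).
  rewrite [x + s' *: v + _]addrAC in e2; apply: etrans (esym e1) _.
  apply: etrans _ e2; rewrite [x + h *: v + _]addrAC !opprB.
  by rewrite addrACA [RHS]addrACA; congr (_ + _); exact: addrC.
by apply: dist_half n2 _; rewrite -eqD.
Qed.

Lemma derive_sym E F (U : set E) (f : E -> F) (x u v : E) : finite_dim F ->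
  open U -> U x -> Ck_on 2 U f -> 'D_u ('D_v f) x = 'D_v ('D_u f) x.
Proof.
move=> [m [b [c [cc cE]]]] oU Ux hf.
have cinj y z : (forall i, c i y = c i z) -> y = z.
  move=> yz; rewrite (cE y) (cE z).
  by apply: eq_bigr => i _; rewrite yz.
apply: cinj => i.
have [df hf'] := hf.
have E1 w y : U y -> 'D_w (c i \o f) y = c i ('D_w f y).
  move=> Uy; rewrite (derive_comp w (df y Uy) (linear_differentiable _ (cc i))).
  by rewrite derive_lin.
have E2 w z : 'D_w ('D_z (c i \o f)) x = c i ('D_w ('D_z f) x).
  have [dz _] := hf' z.
  rewrite -[RHS](derive_lin (f x) _ (cc i)).
  rewrite (near_eq_derive _ (open_near_eq oU Ux (fun y Uy => E1 z y Uy))).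
  rewrite [LHS](derive_comp w (dz x Ux) (linear_differentiable _ (cc i))).
  by rewrite !derive_lin.
have hcf := Ck_on_lincomp oU (cc i) hf.
by rewrite -(E2 u v) -(E2 v u); exact: (derive_sym_scalar u v oU Ux hcf).
Qed.

End Schwarz.

(** * Smoothness at a point and the tangent map *)

Section SmoothAt.
Context {R : realType}.
Implicit Types E F H : normedModType R.

Lemma near_comp (S T : topologicalType) (f : S -> T) x (P : T -> Prop) :
  {for x, continuous f} -> (\forall y \near f x, P y) ->
  \forall z \near x, P (f z).
Proof. by move=> cf Pf; exact: cf. Qed.

Definition smooth_at E F (x : E) (f : E -> F) :=
  exists2 U : set E, open_nbhs x U & smooth_on U f.

Lemma smooth_on_at E F (U : set E) (f : E -> F) x : open U -> U x ->
  smooth_on U f -> smooth_at x f.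
Proof. by move=> oU Ux hf; exists U. Qed.

(** Together with [smooth_on_at], reduces smoothness on an open set to
    smoothness at each point, where charts may be chosen freely. *)
Lemma smooth_at_on E F (U : set E) (f : E -> F) :
  (forall x, U x -> smooth_at x f) -> smooth_on U f.
Proof.
move=> h k; apply: Ck_on_local => x /h[V [oV Vx] hV].
by exists V => //; exact: hV.
Qed.

Lemma smooth_at_near E F (f : E -> F) x : smooth_at x f ->
  \forall y \near x, smooth_at y f.
Proof.
move=> [U xU hU]; have [oU _] := xU.
apply: filterS (open_nbhs_nbhs xU) => y Uy.
by exists U.
Qed.

Lemma smooth_at_diff E F (f : E -> F) x : smooth_at x f -> differentiable f x.
Proof. by move=> [U [_ Ux] hU]; have [df _] := hU 1%N; exact: df. Qed.

Lemma near_differentiable_comp E F H (g : E -> F) (f : F -> H) x :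
  {for x, continuous g} -> smooth_at (g x) f ->
  \forall y \near x, differentiable f (g y).
Proof.
move=> cg /smooth_at_near/(near_comp cg); apply: filterS => y.
exact: smooth_at_diff.
Qed.

Lemma smooth_at_derive E F (f : E -> F) x v : smooth_at x f ->
  smooth_at x ('D_v f).
Proof.
by move=> [U xU hU]; exists U => // k; have [_ h] := hU k.+1; exact: h.
Qed.

Lemma smooth_at_eq E F (f g : E -> F) x : (\near x, f x = g x) ->
  smooth_at x f -> smooth_at x g.
Proof.
move=> fg [U [oU Ux] hU].
pose V := [set y | f y = g y]^°.
exists (U `&` V).
  split; first by apply: openI => //; exact: open_interior.
  by split.
move=> k; apply: (@Ck_on_eq _ _ _ _ _ f).
- by apply: openI => //; exact: open_interior.
- by move=> y [_ Vy]; exact: (interior_subset Vy).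
- by apply: (Ck_on_sub _ (hU k)) => y [].
Qed.

Lemma smooth_at_cst E F (a : F) (x : E) : smooth_at x (fun=> a).
Proof.
by exists setT; [split=> //; exact: openT|move=> k; exact: Ck_on_cst].
Qed.

Lemma smooth_at_lin E F (f : {linear E -> F}) x : continuous f -> smooth_at x f.
Proof.
move=> cf; exists setT; first by split=> //; exact: openT.
by move=> k; exact: Ck_on_lin.
Qed.

Lemma smooth_at_fst E F (p : E * F) : smooth_at p fst.
Proof. by apply: smooth_at_lin => q; exact: cvg_fst. Qed.

Lemma smooth_at_snd E F (p : E * F) : smooth_at p snd.
Proof. by apply: smooth_at_lin => q; exact: cvg_snd. Qed.

Lemma smooth_at_pair E F H (f : E -> F) (g : E -> H) x :
  smooth_at x f -> smooth_at x g -> smooth_at x (fun y => (f y, g y)).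
Proof.
move=> [U [oU Ux] hU] [V [oV Vx] hV].
have oUV : open (U `&` V) by exact: openI.
exists (U `&` V) => // k; apply: Ck_on_pair => //.
  by apply: (Ck_on_sub _ (hU k)) => y [].
by apply: (Ck_on_sub _ (hV k)) => y [].
Qed.

Lemma smooth_at_comp E F H (f : E -> F) (g : F -> H) x : finite_dim F ->
  smooth_at x f -> smooth_at (f x) g -> smooth_at x (g \o f).
Proof.
move=> fF [U [oU Ux] hU] [W [oW Wx] hW].
have oV : open (U `&` f @^-1` W).
  rewrite openE => y [Uy Wy]; apply: (@filterI _ (nbhs y)).
    exact: open_nbhs_nbhs.
  exact: (hU 0%N y Uy) (open_nbhs_nbhs (conj oW Wy)).
exists (U `&` f @^-1` W) => // k.
apply: (Ck_on_comp fF oV _ _ (hW k)); first by move=> y [].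
by apply: (Ck_on_sub _ (hU k)) => y [].
Qed.

Lemma smooth_at_tangent E F (f : E -> F) x w : finite_dim E -> smooth_at x f ->
  smooth_at (x, w) (fun p : E * E => 'D_(p.2) f p.1).
Proof.
move=> fE [U [oU Ux] hU]; exists (U `*` [set: E]).
  by split=> //; apply: open_setX => //; exact: openT.
by move=> k; exact: Ck_on_tangent.
Qed.

Lemma derive_slice1 E F H (f : E * F -> H) x y u :
  'D_(u, 0) f (x, y) = 'D_u (fun x => f (x, y)) x.
Proof.
rewrite /derive.
rewrite (_ : (fun h => _) = (fun h : R => h^-1 *:
  (((fun x => f (x, y)) \o shift x) (h *: u) - f (x, y)))) //.
apply/funext => h /=.
by congr (_ *: (f _ - _)); congr pair; rewrite /= scaler0 add0r.
Qed.

Lemma derive_slice2 E F H (f : E * F -> H) x y v :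
  'D_(0, v) f (x, y) = 'D_v (fun y => f (x, y)) y.
Proof.
rewrite /derive.
rewrite (_ : (fun h => _) = (fun h : R => h^-1 *:
  (((fun y => f (x, y)) \o shift y) (h *: v) - f (x, y)))) //.
apply/funext => h /=.
by congr (_ *: (f _ - _)); congr pair; rewrite /= scaler0 add0r.
Qed.

(** The rule for differentiating a derivative whose base point and direction
    both move: split the variation of the pair (point, direction), the
    dependence on the direction being linear. *)
Lemma derive_tangent_comp E F H (f : F -> H) (p w : E -> F) x u :
  finite_dim F -> smooth_at (p x) f -> differentiable p x ->
  differentiable w x ->
  'D_u (fun y => 'D_(w y) f (p y)) x =
  'D_('D_u p x) ('D_(w x) f) (p x) + 'D_('D_u w x) f (p x).
Proof.
move=> fF sf dp dw; have df := smooth_at_diff sf.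
have dT := smooth_at_diff (smooth_at_tangent (w x) fF sf).
rewrite [LHS](derive_comp u (differentiable_pair dp dw) dT).
rewrite (derive_pair u dp dw).
rewrite (_ : ('D_u p x, 'D_u w x) = ('D_u p x, 0) + (0, 'D_u w x)); last first.
  by congr pair; rewrite /= ?addr0 ?add0r.
rewrite (derive_dirD _ _ dT) derive_slice1 derive_slice2 /=; congr (_ + _).
rewrite (_ : (fun v => 'D_v f (p x)) = 'd f (p x)).
  rewrite (derive_lin _ _ (diff_continuous df)).
  by rewrite (deriveE _ df).
by apply/funext => v; rewrite (deriveE _ df).
Qed.

End SmoothAt.

(** * Second-order calculus of a local group law *)

Section LocalGroup.
Context {R : realType} {E : normedModType R}.
Hypothesis fE : finite_dim E.

(** For a group law [m] in a chart with identity [e], the field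
    ['D_(0, v) m (y, e)] is the left-invariant one of [v]; this is its
    derivative along [u], and the Lie bracket is its antisymmetrization. *)
Definition mixed_derive (m : E * E -> E) (e u v : E) :=
  'D_(u, 0) ('D_(0, v) m) (e, e).

Lemma derive_near_id (F : normedModType R) (f : F -> F) x v :
  (\near x, f x = x) -> 'D_v f x = v.
Proof. by move=> h; rewrite (near_eq_derive _ h) derive_id. Qed.

Lemma derive_near_cst (F H : normedModType R) (f : F -> H) (a : H) x v :
  (\near x, f x = a) -> 'D_v f x = 0.
Proof.
by move=> h; rewrite (@near_eq_derive _ _ _ _ (cst a) _ _ h) derive_cst.
Qed.

Variables (e : E) (m a : E * E -> E).
Hypothesis (sm : smooth_at (e, e) m) (sa : smooth_at (e, e) a).
Hypothesis (m1 : \forall y \near e, m (y, e) = y).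
Hypothesis (m2 : \forall z \near e, m (e, z) = z).
Hypothesis (a1 : \forall y \near e, a (y, e) = e).
Hypothesis (a2 : \forall z \near e, a (e, z) = z).

Let Dm1 u : 'D_(u, 0) m (e, e) = u.
Proof. by rewrite derive_slice1; exact: derive_near_id. Qed.

Let Dm2 u : 'D_(0, u) m (e, e) = u.
Proof. by rewrite derive_slice2; exact: derive_near_id. Qed.

Let Da1 u : 'D_(u, 0) a (e, e) = 0.
Proof. by rewrite derive_slice1; exact: derive_near_cst a1. Qed.

Let Da2 u : 'D_(0, u) a (e, e) = u.
Proof. by rewrite derive_slice2; exact: derive_near_id. Qed.

Let aee : a (e, e) = e.
Proof. exact: nbhs_singleton a1. Qed.

Let dfst (p : E * E) : differentiable (fst : E * E -> E) p.
Proof. exact: smooth_at_diff (smooth_at_fst p). Qed.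

Let dsnd (p : E * E) : differentiable (snd : E * E -> E) p.
Proof. exact: smooth_at_diff (smooth_at_snd p). Qed.

Let Dfst (p w : E * E) : 'D_w (fst : E * E -> E) p = w.1.
Proof. by apply: derive_lin => q; exact: cvg_fst. Qed.

Let Dsnd (p w : E * E) : 'D_w (snd : E * E -> E) p = w.2.
Proof. by apply: derive_lin => q; exact: cvg_snd. Qed.

Lemma mixed_derive_sym u v :
  'D_(0, u) ('D_(v, 0) m) (e, e) = mixed_derive m e v u.
Proof.
have [U [oU Ue] hU] := sm.
exact: (derive_sym _ _ fE oU Ue (hU 2%N)).
Qed.

(** The infinitesimal form of the fact that the derivative of [Ad] is the
    bracket. Conjugation [a] satisfies [a(y, z) y = y z]; differentiating in [z]
    and then in [y] at the identity gives
    [mixed_derive a e u v + mixed_derive m e v u = mixed_derive m e u v],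
    where the middle term comes from the symmetry of second derivatives. *)
Lemma mixed_derive_conj u v : (\forall p \near (e, e), m (a p, p.1) = m p) ->
  mixed_derive a e u v = mixed_derive m e u v - mixed_derive m e v u.
Proof.
move=> am; apply/eqP; rewrite eq_sym subr_eq; apply/eqP.
have fEE := finite_dim_prod fE fE.
pose P (p : E * E) := (a p, p.1).
have dP p : smooth_at p a -> differentiable P p.
  by move=> /smooth_at_diff da; apply: differentiable_pair => //; exact: dfst.
have DP p w : smooth_at p a -> 'D_w P p = ('D_w a p, w.1).
  move=> /smooth_at_diff da.
  by rewrite (derive_pair w da (dfst p)) Dfst.
have Pee : P (e, e) = (e, e) by rewrite /P aee.
have smP : smooth_at (P (e, e)) m by rewrite Pee.
(* first derivative, in z, of a(y, z) y = y z at all points near (e, e) *)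
have nearD : \forall p \near (e, e),
    'D_('D_(0, v) a p, 0) m (P p) = 'D_(0, v) m p.
  have nsm : \forall p \near (e, e), smooth_at (P p) m.
    exact: (differentiable_continuous (dP _ sa)) (smooth_at_near smP).
  move: (smooth_at_near sa) nsm (near_join am).
  apply: filterS3 => p sap smp amp.
  rewrite -(near_eq_derive _ amp).
  by rewrite [RHS](derive_comp _ (dP p sap) (smooth_at_diff smp)) DP.
rewrite [LHS]/mixed_derive -[LHS](near_eq_derive _ nearD).
have dw : differentiable (fun p => ('D_(0, v) a p, 0 : E)) (e, e).
  apply: differentiable_pair; last exact: differentiable_cst.
  exact: smooth_at_diff (smooth_at_derive _ sa).
rewrite (derive_tangent_comp _ fEE smP (dP _ sa) dw) Pee DP// Da1 Da2 /=.
rewrite mixed_derive_sym addrC; congr (_ + _).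
have dDa := smooth_at_diff (smooth_at_derive (0, v) sa).
by rewrite (derive_pair _ dDa (differentiable_cst _ _)) derive_cst Dm1.
Qed.

(** For the twisted product [y a(b y, z)], the point at which the
    derivative in [z] is taken varies with [y] through the left factor, which
    gives the term of [m], and through [b], which gives the term of [a]. *)
Lemma mixed_derive_twist (b : E -> E) (m' : E * E -> E) u v :
  smooth_at e b -> b e = e ->
  (\forall p \near (e, e), m' p = m (p.1, a (b p.1, p.2))) ->
  mixed_derive m' e u v = mixed_derive m e u v + mixed_derive a e ('D_u b e) v.
Proof.
move=> sb be m'E; have fEE := finite_dim_prod fE fE.
pose Q (p : E * E) := (b p.1, p.2).
pose P (p : E * E) := (p.1, a (Q p)).
have dQ p : differentiable b p.1 -> differentiable Q p.
  move=> db; apply: differentiable_pair; last exact: dsnd.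
  exact: differentiable_comp (dfst p) db.
have DQ p w : differentiable b p.1 -> 'D_w Q p = ('D_(w.1) b p.1, w.2).
  move=> db; rewrite (derive_pair w (differentiable_comp (dfst p) db) (dsnd p)).
  by rewrite (derive_comp w (dfst p) db) Dfst Dsnd.
have dP p : differentiable b p.1 -> differentiable a (Q p) ->
    differentiable P p.
  move=> db da; apply: differentiable_pair; first exact: dfst.
  exact: differentiable_comp (dQ p db) da.
have DP p w : differentiable b p.1 -> differentiable a (Q p) ->
    'D_w P p = (w.1, 'D_('D_(w.1) b p.1, w.2) a (Q p)).
  move=> db da.
  rewrite (derive_pair w (dfst p) (differentiable_comp (dQ p db) da)) Dfst.
  by rewrite (derive_comp w (dQ p db) da) DQ.
have Qee : Q (e, e) = (e, e) by rewrite /Q /= be.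
have Pee : P (e, e) = (e, e) by rewrite /P Qee aee.
have db : differentiable b (e, e).1 by exact: smooth_at_diff.
have saQ : smooth_at (Q (e, e)) a by rewrite Qee.
have smP : smooth_at (P (e, e)) m by rewrite Pee.
have nb : \forall p \near (e, e), differentiable b p.1.
  exact: (@near_differentiable_comp _ _ _ _ fst b (e, e)
    (differentiable_continuous (dfst _)) sb).
have na : \forall p \near (e, e), differentiable a (Q p).
  exact: (@near_differentiable_comp _ _ _ _ Q a (e, e)
    (differentiable_continuous (dQ _ db)) saQ).
have nm : \forall p \near (e, e), differentiable m (P p).
  apply: (@near_differentiable_comp _ _ _ _ P m (e, e) _ smP).
  exact/differentiable_continuous/dP/smooth_at_diff.
have nearD : \forall p \near (e, e),
    'D_(0, 'D_(0, v) a (Q p)) m (P p) = 'D_(0, v) m' p.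
  have nba : \forall p \near (e, e),
      differentiable b p.1 /\ differentiable a (Q p).
    exact: filterI nb na.
  have m'P : \forall p \near (e, e), m' p = (m \o P) p by exact: m'E.
  move: nba (near_join m'P) nm.
  apply: filterS3 => p [dbp dap] m'p dmp.
  rewrite (near_eq_derive _ m'p) (derive_comp _ (dP p dbp dap) dmp).
  rewrite (DP _ _ dbp dap) /=.
  by rewrite derive0.
rewrite [LHS]/mixed_derive -[LHS](near_eq_derive _ nearD).
have dDa : differentiable ('D_(0, v) a) (Q (e, e)).
  by rewrite Qee; exact: smooth_at_diff (smooth_at_derive _ sa).
have dDaQ := differentiable_comp (dQ _ db) dDa.
have dw : differentiable (fun p => (0 : E, 'D_(0, v) a (Q p))) (e, e).
  by apply: differentiable_pair; [exact: differentiable_cst|exact: dDaQ].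
rewrite (derive_tangent_comp _ fEE smP (dP _ db (smooth_at_diff saQ)) dw) Pee.
rewrite (DP _ _ db (smooth_at_diff saQ)) Qee Da1 Da2 /=; congr (_ + _).
rewrite (derive_pair _ (differentiable_cst _ _) dDaQ) derive_cst Dm2.
by rewrite [LHS](derive_comp _ (dQ _ db) dDa) DQ// Qee.
Qed.

(** The local form of the bracket formula: antisymmetrize [mixed_derive_twist] and
    recognize brackets of [m] through [mixed_derive_conj]. *)
Lemma mixed_derive_bracket (b : E -> E) (m' : E * E -> E) u v :
  smooth_at e b -> b e = e -> (\forall p \near (e, e), m (a p, p.1) = m p) ->
  (\forall p \near (e, e), m' p = m (p.1, a (b p.1, p.2))) ->
  let br m u v := mixed_derive m e u v - mixed_derive m e v u in
  br m' u v = br m ('D_u b e) v + br m u ('D_v b e) + br m u v.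
Proof.
move=> sb be am m'E /=.
rewrite !(mixed_derive_twist _ _ sb be m'E) !mixed_derive_conj//.
(* what remains is an identity in the additive group *)
move: (mixed_derive m e u v) (mixed_derive m e v u).
move: (mixed_derive m e ('D_u b e) v) (mixed_derive m e v ('D_u b e)).
move: (mixed_derive m e ('D_v b e) u) (mixed_derive m e u ('D_v b e)).
move=> p q r s x y; rewrite opprD addrACA [LHS]addrC; congr (_ + _).
by rewrite opprB.
Qed.

End LocalGroup.

(** * Charts and smooth maps *)

Section Charts.
Context {R : realType}.

Lemma image_setX (T T' : Type) (E E' : Type) (f : T -> E) (g : T' -> E')
    (U : set T) (V : set T') :
  (fun p => (f p.1, g p.2)) @` (U `*` V) = (f @` U) `*` (g @` V).
Proof.
apply/seteqP; split=> [_ [[x y] [/= Ux Vy] <-]|[_ _] [/= [x Ux <-] [y Vy <-]]].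
  by split; [exists x|exists y].
by exists (x, y).
Qed.

Section OneChart.
Context {T : topologicalType} {E : normedModType R} (c : chart T E).
Hypothesis cc : is_chart c.

Lemma chartK p : cdom c p -> cinv c (cmap c p) = p.
Proof. by case: cc => _ _ h _ _; exact: h. Qed.

Lemma chart_invK y : (cmap c @` cdom c) y -> cmap c (cinv c y) = y.
Proof. by move=> [p cp <-]; rewrite chartK. Qed.

Lemma chart_open_nbhs p : cdom c p -> open_nbhs p (cdom c).
Proof. by case: cc => o _ _ _ _ cp; split. Qed.

Lemma chart_inv_near p (P : T -> Prop) : cdom c p -> (\forall q \near p, P q) ->
  \forall y \near cmap c p, P (cinv c y).
Proof.
case: cc => _ _ _ _ hc cp Pp; have := hc p cp.
by rewrite /prop_for /continuous_at chartK //; apply.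
Qed.

Lemma chart_image_near p : cdom c p ->
  \forall y \near cmap c p, (cmap c @` cdom c) y.
Proof.
move=> cp; apply: open_nbhs_nbhs; case: cc => _ o _ _ _.
by split=> //; exists p.
Qed.

Lemma chart_invK_near p : cdom c p ->
  \forall y \near cmap c p, cmap c (cinv c y) = y.
Proof. by move=> /chart_image_near; apply: filterS => y /chart_invK. Qed.

Lemma chart_image_open (W : set T) : open W -> open (cmap c @` (cdom c `&` W)).
Proof.
move=> oW; rewrite openE => _ [p [cp Wp] <-].
have nW := chart_inv_near cp (open_nbhs_nbhs (conj oW Wp)).
apply: filterS2 (chart_image_near cp) nW => y yc Wy.
exists (cinv c y); last exact: chart_invK.
by split=> //; case: yc => q cq <-; rewrite chartK.
Qed.

End OneChart.

Lemma is_chart_prod (T T' : topologicalType) (E E' : normedModType R)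
    (c : chart T E) (d : chart T' E') :
  is_chart c -> is_chart d -> is_chart (prod_chart c d).
Proof.
move=> [c1 c2 c3 c4 c5] [d1 d2 d3 d4 d5]; split=> /=.
- exact: open_setX.
- by rewrite image_setX; exact: open_setX.
- by move=> [p q] [/= cp dq]; rewrite c3// d3.
- move=> [p q] [/= cp dq].
  apply: cvg_pair.
    by apply: (@continuous_comp _ _ _ fst (cmap c)); [exact: cvg_fst|exact: c4].
  by apply: (@continuous_comp _ _ _ snd (cmap d)); [exact: cvg_snd|exact: d4].
- move=> [p q] [/= cp dq].
  apply: cvg_pair.
    by apply: (@continuous_comp _ _ _ fst (cinv c)); [exact: cvg_fst|exact: c5].
  by apply: (@continuous_comp _ _ _ snd (cinv d)); [exact: cvg_snd|exact: d5].
Qed.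

(** The conditions under which smooth maps compose, isolated from [is_manifold]
    because they pass directly to product atlases. *)
Definition charted (T : topologicalType) (E : normedModType R)
    (A : set (chart T E)) :=
  (forall c, A c -> is_chart c) /\ (forall p, exists2 c, A c & cdom c p).

Lemma charted_prod (T T' : topologicalType) (E E' : normedModType R)
    (A : set (chart T E)) (A' : set (chart T' E')) :
  charted A -> charted A' -> charted (prod_atlas A A').
Proof.
move=> [cA covA] [cA' covA']; split=> [_ [c [d [Ac A'd ->]]]|[p q]].
  by apply: is_chart_prod; [exact: cA|exact: cA'].
have [c Ac cp] := covA p; have [d A'd dq] := covA' q.
by exists (prod_chart c d) => //; exists c, d.
Qed.

Lemma chart_atP (T : topologicalType) (E : normedModType R)
    (A : set (chart T E)) p : charted A ->
  A (chart_at A p) /\ cdom (chart_at A p) p.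
Proof.
move=> [_ /(_ p)[c Ac cp]].
exact: (@xgetPex _ _ [set c | A c /\ cdom c p] (ex_intro _ c (conj Ac cp))).
Qed.

End Charts.

Section SmoothMaps.
Context {R : realType}.

Section Pointwise.
Context {T T' : topologicalType} {E E' : normedModType R}.
Context {A : set (chart T E)} {A' : set (chart T' E')}.
Hypotheses (hA : charted A) (hA' : charted A').

(** Pointwise form of smoothness, with charts quantified at the point; every
    construction of smooth maps below goes through it. *)
Lemma smooth_mapP (f : T -> T') : smooth_map A A' f <->
  continuous f /\ forall c d p, A c -> A' d -> cdom c p -> cdom d (f p) ->
    smooth_at (cmap c p) (cmap d \o f \o cinv c).
Proof.
split=> [] [cf hf]; split=> // c d.
  move=> p Ac A'd cp dfp; apply: smooth_on_at (hf c d Ac A'd); last by exists p.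
  apply: (chart_image_open (hA.1 _ Ac)).
  by apply: open_comp => [x _|]; [exact: cf|case: (hA'.1 _ A'd)].
by move=> Ac A'd; apply: smooth_at_on => _ [p [cp dfp] <-]; exact: hf.
Qed.

Lemma smooth_map_cst (a : T') : smooth_map A A' (fun=> a).
Proof.
apply/smooth_mapP; split=> [x|c d p _ _ _ _]; first exact: cvg_cst.
exact: smooth_at_cst.
Qed.

End Pointwise.

Lemma smooth_map_comp (T1 T2 T3 : topologicalType) (E1 E2 E3 : normedModType R)
    (A1 : set (chart T1 E1)) (A2 : set (chart T2 E2)) (A3 : set (chart T3 E3))
    (f : T1 -> T2) (g : T2 -> T3) :
  charted A1 -> charted A2 -> charted A3 -> finite_dim E2 ->
  smooth_map A1 A2 f -> smooth_map A2 A3 g -> smooth_map A1 A3 (g \o f).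
Proof.
move=> h1 h2 h3 fE /(smooth_mapP h1 h2)[cf sf] /(smooth_mapP h2 h3)[cg sg].
apply/(smooth_mapP h1 h3); split=> [x|c d p Ac Ad cp dp].
  exact: (continuous_comp (cf x) (cg _)).
(* any chart e around f p factors g \o f near p *)
have [e Ae ep] := h2.2 (f p).
have := smooth_at_comp fE (sf c e p Ac Ae cp ep).
have -> : (cmap e \o f \o cinv c) (cmap c p) = cmap e (f p).
  by rewrite /= (chartK (h1.1 _ Ac) cp).
move=> /(_ _ _ (sg e d (f p) Ae Ad ep dp)); apply: smooth_at_eq.
have nfe : \forall q \near p, cdom e (f q).
  exact: cf p _ (open_nbhs_nbhs (chart_open_nbhs (h2.1 _ Ae) ep)).
apply: filterS (chart_inv_near (h1.1 _ Ac) cp nfe) => y ey /=.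
by rewrite (chartK (h2.1 _ Ae)).
Qed.

Lemma smooth_map_pair (T T1 T2 : topologicalType) (E E1 E2 : normedModType R)
    (A : set (chart T E)) (A1 : set (chart T1 E1)) (A2 : set (chart T2 E2))
    (f : T -> T1) (g : T -> T2) :
  charted A -> charted A1 -> charted A2 ->
  smooth_map A A1 f -> smooth_map A A2 g ->
  smooth_map A (prod_atlas A1 A2) (fun x => (f x, g x)).
Proof.
move=> h h1 h2 /(smooth_mapP h h1)[cf sf] /(smooth_mapP h h2)[cg sg].
apply/(smooth_mapP h (charted_prod h1 h2)).
split=> [x|c _ p Ac [d [d' [Ad Ad' ->]]]].
  exact: (cvg_pair (cf x) (cg x)).
move=> cp [/= dp d'p].
exact: (smooth_at_pair (sf c d p Ac Ad cp dp) (sg c d' p Ac Ad' cp d'p)).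
Qed.

(** Compatibility of the charts is the smoothness of the identity. *)
Lemma manifold_charted (T : topologicalType) (E : normedModType R)
    (A : set (chart T E)) : is_manifold A -> charted A /\ smooth_map A A id.
Proof.
by case=> _ _ cA covA comp; do 2!split=> //; move=> x; exact: cvg_id.
Qed.

Lemma smooth_map_fst (T T' : topologicalType) (E E' : normedModType R)
    (A : set (chart T E)) (A' : set (chart T' E')) :
  finite_dim E -> charted A' -> is_manifold A ->
  smooth_map (prod_atlas A A') A fst.
Proof.
move=> fE h' /manifold_charted[h /(smooth_mapP h h)[_ sid]].
apply/(smooth_mapP (charted_prod h h') h); split=> [x|]; first exact: cvg_fst.
move=> _ d [p q] [c [c' [Ac _ ->]]] Ad [/= cp _] dp.
exact: (smooth_at_comp fE (smooth_at_fst (cmap c p, cmap c' q))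
  (sid c d p Ac Ad cp dp)).
Qed.

Lemma smooth_map_snd (T T' : topologicalType) (E E' : normedModType R)
    (A : set (chart T E)) (A' : set (chart T' E')) :
  finite_dim E' -> charted A -> is_manifold A' ->
  smooth_map (prod_atlas A A') A' snd.
Proof.
move=> fE h /manifold_charted[h' /(smooth_mapP h' h')[_ sid]].
apply/(smooth_mapP (charted_prod h h') h'); split=> [x|]; first exact: cvg_snd.
move=> _ d [p q] [c [c' [Ac Ac' ->]]] Ad [/= _ cq] dq.
exact: (smooth_at_comp fE (smooth_at_snd (cmap c p, cmap c' q))
  (sid c' d q Ac' Ad cq dq)).
Qed.

End SmoothMaps.

(** * Algebra of the descendent group *)

Section GroupFacts.
Context {T : Type} (G : group_ops T) (B : T -> T).
Hypothesis gG : is_group G.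
Local Notation "x ** y" := (gmul G x y) (at level 40, left associativity).
Local Notation e := (gone G).
Local Notation inv := (@ginv T G).

Let mulA : associative (gmul G). Proof. by case: gG. Qed.
Let mul1 : left_id e (gmul G). Proof. by case: gG. Qed.
Let mul_1 : right_id e (gmul G). Proof. by case: gG. Qed.
Let mulV : left_inverse e inv (gmul G). Proof. by case: gG. Qed.
Let mul_V : right_inverse e inv (gmul G). Proof. by case: gG. Qed.

Let mulKV x y : x ** inv y ** y = x.
Proof. by rewrite -mulA mulV mul_1. Qed.

Let mulVK x y : x ** y ** inv y = x.
Proof. by rewrite -mulA mul_V mul_1. Qed.

Let mulI x : injective (gmul G x).
Proof. by move=> y z /(congr1 (gmul G (inv x))); rewrite !mulA mulV !mul1. Qed.

Let invM x y : inv (x ** y) = inv y ** inv x.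
Proof. by apply: (@mulI (x ** y)); rewrite mul_V mulA mulVK mul_V. Qed.

Lemma Ad_mulg x y : Ad G x y ** x = x ** y.
Proof. exact: mulKV. Qed.

Lemma Ad_g1 x : Ad G x e = e.
Proof. by rewrite /Ad mul_1 mul_V. Qed.

Lemma Ad_1g x : Ad G e x = x.
Proof. by rewrite /Ad mul1 -[RHS](mulVK x e) mul_1. Qed.

Lemma AdM x y z : Ad G x (y ** z) = Ad G x y ** Ad G x z.
Proof. by rewrite /Ad !mulA mulKV. Qed.

Lemma Ad_comp x y z : Ad G (x ** y) z = Ad G x (Ad G y z).
Proof. by rewrite /Ad invM !mulA. Qed.

Hypothesis BM : forall g1 g2, B g1 ** B g2 = B (rb_mul G B g1 g2).

Lemma rota_baxter1 : B e = e.
Proof.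
apply: (@mulI (B e)); rewrite mul_1 BM /rb_mul mul1.
by rewrite Ad_g1.
Qed.

(** Solves [g * h = e] for the descendent product, since [Ad] is an action. *)
Definition rb_inv g := Ad G (inv (B g)) (inv g).

(** Associativity is the action law of [Ad] along [B], which turns the
    descendent product into the original one. *)
Lemma rb_mul_group : is_group (GroupOps (rb_mul G B) e rb_inv).
Proof.
have bA : associative (rb_mul G B).
  move=> x y z; rewrite {2 3}/rb_mul.
  rewrite [in LHS]/rb_mul -BM AdM mulA Ad_comp.
  by [].
have b1 : left_id e (rb_mul G B).
  by move=> x; rewrite /rb_mul rota_baxter1 mul1 Ad_1g.
have b_1 : right_id e (rb_mul G B) by move=> x; rewrite /rb_mul Ad_g1 mul_1.
have b_V : right_inverse e rb_inv (rb_mul G B).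
  by move=> x; rewrite /rb_mul /rb_inv -Ad_comp mul_V Ad_1g mul_V.
have bV : left_inverse e rb_inv (rb_mul G B).
  (* in a monoid a right inverse that itself has a right inverse is two-sided *)
  move=> x; have xE : rb_inv (rb_inv x) = x.
    by rewrite -[RHS]b_1 -(b_V (rb_inv x)) bA b_V b1.
  by rewrite -[X in rb_mul _ _ _ X]xE b_V.
by split.
Qed.

Lemma rota_baxterV g : B (rb_inv g) = inv (B g).
Proof.
apply: (@mulI (B g)); rewrite BM mul_V -rota_baxter1; congr B.
by rewrite /rb_mul /rb_inv -Ad_comp mul_V Ad_1g mul_V.
Qed.

(** [B] carries conjugation of the descendent group to conjugation of [G],
    being a homomorphism between them; the claim follows. *)
Lemma rb_mul_rota_baxter g1 g2 :
  let G' := GroupOps (rb_mul G B) e rb_inv in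
  rb_mul G B (B g1) (B g2) = B (rb_mul G B g1 (Ad G' (B g1) g2)).
Proof. by rewrite /= /Ad /= -!BM rota_baxterV. Qed.

End GroupFacts.

(** * The Lie bracket in a chart at the identity *)

Section LieGroup.
Context {R : realType} {T : topologicalType} {E : normedModType R}.
Context (A : set (chart T E)) (G : group_ops T).
Hypotheses (fE : finite_dim E) (lG : is_lie_group A G).

Let gG : is_group G. Proof. by case: lG. Qed.
Let mA : is_manifold A. Proof. by case: lG. Qed.
Let hA : charted A := (manifold_charted mA).1.
Let hAA : charted (prod_atlas A A) := charted_prod hA hA.
Let smul : smooth_map (prod_atlas A A) A (fun p => gmul G p.1 p.2).
Proof. by case: lG. Qed.
Let sinv : smooth_map A A (@ginv T G).
Proof. by case: lG. Qed.

Lemma smooth_map_mul (T0 : topologicalType) (E0 : normedModType R)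
    (A0 : set (chart T0 E0)) (f g : T0 -> T) : charted A0 ->
  smooth_map A0 A f -> smooth_map A0 A g ->
  smooth_map A0 A (fun x => gmul G (f x) (g x)).
Proof.
move=> h0 sf sg; have fEE := finite_dim_prod fE fE.
exact: (smooth_map_comp h0 hAA hA fEE (smooth_map_pair h0 hA hA sf sg) smul).
Qed.

Lemma smooth_map_Ad (T0 : topologicalType) (E0 : normedModType R)
    (A0 : set (chart T0 E0)) (f g : T0 -> T) : charted A0 ->
  smooth_map A0 A f -> smooth_map A0 A g ->
  smooth_map A0 A (fun x => Ad G (f x) (g x)).
Proof.
move=> h0 sf sg; apply: smooth_map_mul => //; first exact: smooth_map_mul.
exact: (smooth_map_comp h0 hA hA fE sf sinv).
Qed.

Lemma smooth_map_Ad2 :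
  smooth_map (prod_atlas A A) A (fun p : T * T => Ad G p.1 p.2).
Proof.
apply: smooth_map_Ad => //; first exact: smooth_map_fst.
exact: smooth_map_snd.
Qed.

Lemma smooth_left_mul g : smooth_map A A (gmul G g).
Proof.
apply: (smooth_map_mul hA (smooth_map_cst hA hA g)).
exact: (manifold_charted mA).2.
Qed.

Local Notation e := (gone G).
Local Notation c := (chart_at A e).
Local Notation e0 := (cmap c e).

Definition in_chart2 (f : T * T -> T) (p : E * E) : E :=
  cmap c (f (cinv c p.1, cinv c p.2)).

Let Ac : A c. Proof. by have [] := chart_atP e hA. Qed.
Let ce : cdom c e. Proof. by have [] := chart_atP e hA. Qed.
Let cc : is_chart c. Proof. exact: hA.1. Qed.
Let cE : cinv c e0 = e. Proof. exact: chartK. Qed.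
Let gm1 : right_id e (gmul G). Proof. by case: gG. Qed.
Let g1m : left_id e (gmul G). Proof. by case: gG. Qed.

Lemma smooth_in_chart2 f : smooth_map (prod_atlas A A) A f -> f (e, e) = e ->
  smooth_at (e0, e0) (in_chart2 f).
Proof.
move=> /(smooth_mapP hAA hA)[_ sf] fe.
have cAA : prod_atlas A A (prod_chart c c) by exists c, c.
have ced : cdom c (f (e, e)) by rewrite fe.
exact: (sf _ c (e, e) cAA Ac (conj ce ce) ced).
Qed.

Lemma chart_inv_near2 (P : T * T -> Prop) : (\forall p \near (e, e), P p) ->
  \forall y \near (e0, e0), P (cinv c y.1, cinv c y.2).
Proof.
move=> nP.
exact: (chart_inv_near (is_chart_prod cc cc) (p := (e, e)) (conj ce ce) nP).
Qed.

(** The field is defined through a different chart at each point; by the chain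
    rule these intermediate charts cancel. *)
Lemma left_inv_vfield_in_chart u : \forall y \near e0,
  vfield_in_chart A c (left_inv_vfield A G u) y =
  'D_(0, u) (in_chart2 (fun p => gmul G p.1 p.2)) (y, e0).
Proof.
apply: filterS (chart_image_near cc ce) => y cy.
rewrite derive_slice2 /vfield_in_chart; set q := cinv c y.
have qc : cdom c q by rewrite /q; case: cy => p cp <-; rewrite (chartK cc).
have [Aq cq] := chart_atP q hA; set d := chart_at A q in Aq cq *.
rewrite /left_inv_vfield /tangent_map gm1 -/d.
have [_ sL] := (smooth_mapP hA hA (gmul G q)).1 (smooth_left_mul q).
have [_ sid] := (smooth_mapP hA hA id).1 (manifold_charted mA).2.
have dq : cdom d (gmul G q e) by rewrite gm1.
have dL := smooth_at_diff (sL c d e Ac Aq ce dq).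
have Le : (cmap d \o gmul G q \o cinv c) e0 = cmap d q.
  by rewrite /= cE gm1.
have dI : differentiable (cmap c \o cinv d) ((cmap d \o gmul G q \o cinv c) e0).
  by rewrite Le; exact: smooth_at_diff (sid d c q Aq Ac cq qc).
rewrite -(deriveE _ dL) -Le -(deriveE _ dI) -(derive_comp u dL dI).
apply: near_eq_derive.
have nd : \forall p \near e, cdom d (gmul G q p).
  have [cL _] := smooth_left_mul q.
  exact: cL e _ (open_nbhs_nbhs (chart_open_nbhs (hA.1 _ Aq) dq)).
apply: filterS (chart_inv_near cc ce nd) => z dz /=.
by rewrite (chartK (hA.1 _ Aq)).
Qed.

(** At the identity a left-invariant field takes the value that generates it, so
    the bracket only involves derivatives of the two fields, which are mixed
    derivatives of the product. *)
Lemma lie_bracketE u v : let m := in_chart2 (fun p => gmul G p.1 p.2) in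
  lie_bracket A G u v = mixed_derive m e0 u v - mixed_derive m e0 v u.
Proof.
move=> m; have sm : smooth_at (e0, e0) m by apply: smooth_in_chart2 => //=.
rewrite /lie_bracket /vfield_bracket.
have Xe w : vfield_in_chart A c (left_inv_vfield A G w) e0 = w.
  rewrite (nbhs_singleton (left_inv_vfield_in_chart w)) derive_slice2.
  apply: derive_near_id; apply: filterS (chart_invK_near cc ce) => y /=.
  by rewrite /in_chart2 /= cE g1m.
have dX w z :
    'd (vfield_in_chart A c (left_inv_vfield A G w)) e0 z =
    mixed_derive m e0 z w.
  have nX := left_inv_vfield_in_chart w.
  have dp : differentiable (fun y => (y, e0)) e0.
    apply: differentiable_pair; last exact: differentiable_cst.
    exact: (@ex_diff _ _ _ _ _ _ _ (is_diff_id e0)).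
  have dF : differentiable (fun y => 'D_(0, w) m (y, e0)) e0.
    exact: (differentiable_comp dp
      (smooth_at_diff (smooth_at_derive (0, w) sm))).
  have dX : differentiable (vfield_in_chart A c (left_inv_vfield A G w)) e0.
    by apply: near_eq_differentiable dF; apply: filterS nX => y ->.
  rewrite -(deriveE _ dX) (near_eq_derive _ nX).
  by rewrite /mixed_derive derive_slice1.
by rewrite !Xe !dX.
Qed.

End LieGroup.

(** * The descendent Lie group *)

Section RotaBaxter.
Context {R : realType} {T : topologicalType} {E : normedModType R}.
Context (A : set (chart T E)) (G : group_ops T) (B : T -> T).
Hypotheses (fE : finite_dim E) (rG : is_rota_baxter_lie_group A G B).

Let lG : is_lie_group A G. Proof. by case: rG. Qed.
Let gG : is_group G. Proof. by case: lG. Qed.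
Let mA : is_manifold A. Proof. by case: lG. Qed.
Let hA : charted A := (manifold_charted mA).1.
Let hAA : charted (prod_atlas A A) := charted_prod hA hA.
Let sB : smooth_map A A B. Proof. by case: rG => _ []. Qed.
Let BM : forall g1 g2, gmul G (B g1) (B g2) = B (rb_mul G B g1 g2).
Proof. by case: rG => _ []. Qed.
Let G' := GroupOps (rb_mul G B) (gone G) (rb_inv G B).

Lemma rb_mul_lie_group : is_lie_group A G'.
Proof.
split=> //; first exact: rb_mul_group.
  apply: (smooth_map_mul fE lG hAA); first exact: smooth_map_fst.
  apply: (smooth_map_Ad fE lG hAA); last exact: smooth_map_snd.
  apply: (smooth_map_comp hAA hA hA fE _ sB); exact: smooth_map_fst.
have sinv : smooth_map A A (@ginv T G) by case: lG.
apply: (smooth_map_Ad fE lG hA) => //.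
exact: (smooth_map_comp hA hA hA fE sB sinv).
Qed.

Lemma rb_mul_rota_baxter_op : is_rota_baxter A G' B.
Proof. by split=> // g1 g2; exact: rb_mul_rota_baxter. Qed.

(** The chart expressions of product, conjugation and [B] satisfy the local
    identities of [mixed_derive_bracket], each as soon as the intermediate group
    elements lie in the domain of the chart at the identity, that is near it. *)
Lemma lie_bracket_rb_mul u v : lie_bracket A G' u v = rb_bracket A G B u v.
Proof.
pose e := gone G; pose c := chart_at A e; pose e0 := cmap c e.
have [Ac ce] : A c /\ cdom c e := chart_atP e hA.
have cc : is_chart c := hA.1 _ Ac.
have cE : cinv c e0 = e by exact: chartK.
have Be : B e = e := rota_baxter1 gG BM.
have [_ g1m gm1 _ gmV] := gG.
pose b := cmap c \o B \o cinv c.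
have sb : smooth_at e0 b.
  have [_ h] := (smooth_mapP hA hA B).1 sB.
  by apply: (h c c e) => //; rewrite Be.
have be : b e0 = e0 by rewrite /b /= cE Be.
pose m := in_chart2 A G (fun p => gmul G p.1 p.2).
pose a := in_chart2 A G (fun p => Ad G p.1 p.2).
have sm : smooth_at (e0, e0) m.
  by apply: (smooth_in_chart2 lG) => /=; [case: lG|exact: gm1].
have sAd := smooth_map_Ad2 fE lG.
have sa : smooth_at (e0, e0) a.
  by apply: (smooth_in_chart2 lG sAd); exact: Ad_g1.
have nK := chart_invK_near cc ce.
have m1 : \forall y \near e0, m (y, e0) = y.
  by apply: filterS nK => y; rewrite /m /in_chart2 /= cE gm1.
have m2 : \forall y \near e0, m (e0, y) = y.
  by apply: filterS nK => y; rewrite /m /in_chart2 /= cE g1m.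
have a1 : \forall y \near e0, a (y, e0) = e0.
  by apply: filterE => y; rewrite /a /in_chart2 /= cE (Ad_g1 gG).
have a2 : \forall y \near e0, a (e0, y) = y.
  by apply: filterS nK => y; rewrite /a /in_chart2 /= cE (Ad_1g gG).
have cnear := open_nbhs_nbhs (chart_open_nbhs cc ce).
have nAd : \forall p \near (e, e), cdom c (Ad G p.1 p.2).
  have [cAd _] := sAd.
  by apply: (near_comp (cAd (e, e))); rewrite /= (Ad_g1 gG).
have nB : \forall p \near (e, e), cdom c (B p.1).
  have [cB _] := smooth_map_comp hAA hA hA fE (smooth_map_fst fE hA mA) sB.
  by apply: (near_comp (cB (e, e))); rewrite /= Be.
have nAdB : \forall p \near (e, e), cdom c (Ad G (B p.1) p.2).
  have [cAd _] := smooth_map_Ad fE lG hAA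
    (smooth_map_comp hAA hA hA fE (smooth_map_fst fE hA mA) sB)
    (smooth_map_snd fE hA mA).
  by apply: (near_comp (cAd (e, e))); rewrite /= (Ad_g1 gG).
have am : \forall p \near (e0, e0), m (a p, p.1) = m p.
  apply: filterS (chart_inv_near2 lG nAd) => p /= ap.
  by rewrite /m /a /in_chart2 /= (chartK cc ap) (Ad_mulg gG).
pose m' := in_chart2 A G' (fun p => rb_mul G B p.1 p.2).
have m'E : \forall p \near (e0, e0), m' p = m (p.1, a (b p.1, p.2)).
  apply: filterS2 (chart_inv_near2 lG nB) (chart_inv_near2 lG nAdB).
  move=> p /= Bp ap.
  by rewrite /m' /m /a /b /in_chart2 /= (chartK cc Bp) (chartK cc ap).
have DB w : tangent_map A A B e w = 'D_w b e0.
  by rewrite /tangent_map Be (deriveE _ (smooth_at_diff sb)).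
rewrite /rb_bracket !(lie_bracketE fE lG).
rewrite (lie_bracketE fE rb_mul_lie_group) !DB.
exact: (mixed_derive_bracket fE sm sa m1 m2 a1 a2 u v sb be am m'E).
Qed.

End RotaBaxter.

Theorem proposition2p14 (R : realType) (n : nat) (T : topologicalType)
    (A : set (chart T 'rV[R]_n)) (G : group_ops T) (B : T -> T)
    (hGB : is_rota_baxter_lie_group A G B) :
  exists inv' : T -> T,
    let G' := GroupOps (rb_mul G B) (gone G) inv' in
    [/\ is_lie_group A G' /\
          (forall u v : 'rV[R]_n, lie_bracket A G' u v = rb_bracket A G B u v),
        is_rota_baxter A G' B &
        is_rota_baxter_hom A A G' B G B B].
Proof.
have fE := @finite_dim_rV R n; exists (rb_inv G B).
have [lG [sB BM]] := hGB.
split; first by split; [exact: rb_mul_lie_group|exact: lie_bracket_rb_mul].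
  exact: rb_mul_rota_baxter_op.
split=> //.
  by split; [exact: rb_mul_lie_group|exact: rb_mul_rota_baxter_op].
by split=> // g1 g2; rewrite BM.
Qed.
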